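(* Let $G$ be a finite group, let $\mathfrak{L}=(V,E,\lambda,\iota)$ be a $\lambda$-graph system over a finite alphabet $\Sigma$, and let $\ell:\Sigma\to G$ be a map. Let $\mathfrak{L}^{G,\ell}$ be the $G$-extension of $\mathfrak{L}$ by $\ell$, and let $\tau_\ell:\Lambda_{\mathfrak{L}}\to G$ be defined by $\tau_\ell((x_n)_{n\in\mathbb{Z}})=\ell(x_0)$. Then the subshift $(\Lambda_{\mathfrak{L}^{G,\ell}},\sigma_{\mathfrak{L}^{G,\ell}})$ presented by $\mathfrak{L}^{G,\ell}$, with the $G$-action $\rho_g((g_n,x_n)_{n\in\mathbb{Z}})=(g g_n,x_n)_{n\in\mathbb{Z}}$, is a $G$-subshift, and it is $G$-conjugate to the skew product $(G\ltimes\Lambda_{\mathfrak{L}},\tau_\ell\ltimes\sigma_{\mathfrak{L}})$.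
   Context: Subshifts: a subshift over a finite alphabet $\Sigma$ is a closed shift-invariant subset of $\Sigma^{\mathbb{Z}}$ with the shift $\sigma((x_i)_i)=(x_{i+1})_i$. A $G$-subshift is a subshift with an action of $G$ by homeomorphisms commuting with the shift. Two systems with $G$-actions commuting with their dynamics are $G$-conjugate if there is a topological conjugacy between them commuting with the $G$-actions. $\lambda$-graph systems: a $\lambda$-graph system $\mathfrak{L}=(V,E,\lambda,\iota)$ over $\Sigma$ consists of a vertex set $V=\bigsqcup_{l\ge 0}V_l$ and an edge set $E=\bigsqcup_{l\ge 0}E_{l,l+1}$ with all $V_l,E_{l,l+1}$ finite, source and terminal maps $s:E_{l,l+1}\to V_l$, $t:E_{l,l+1}\to V_{l+1}$, a labeling map $\lambda:E\to\Sigma$ and surjections $\iota=\iota_{l,l+1}:V_{l+1}\to V_l$, such that: every vertex is the source of some edge; every vertex in $V_l$, $l\ge1$, is the terminal of some edge; for $l\ge 1$ and $v\in V_{l+1}$, there is an edge in $E_{l,l+1}$ labeled $\alpha$ with terminal $v$ if and only if there is an edge in $E_{l-1,l}$ labeled $\alpha$ with terminal $\iota(v)$; and (local property) for $l\ge1$, $u\in V_{l-1}$, $v\in V_{l+1}$ there is a label-preserving bijection between $E^\iota(u,v)=\{e\in E_{l,l+1}: t(e)=v,\ \iota(s(e))=u\}$ and $E_\iota(u,v)=\{e\in E_{l-1,l}: s(e)=u,\ t(e)=\iota(v)\}$. All $\lambda$-graph systems are assumed left-resolving: $t(e)\ne t(f)$ whenever $e\neq f$ and $\lambda(e)=\lambda(f)$.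 The subshift $\Lambda_{\mathfrak{L}}$ presented by $\mathfrak{L}$ is the subshift over $\Sigma$ whose admissible words are exactly the label words of finite paths in $\mathfrak{L}$. Extension: $\mathfrak{L}^{G,\ell}=(V^G,E^G,\lambda^G,\iota^G)$ is the $\lambda$-graph system over $\Sigma^G=G\times\Sigma$ with $V^G_l=G\times V_l$, $E^G_{l,l+1}=G\times E_{l,l+1}$, $\iota^G(g,v)=(g,\iota(v))$, and for $e^g=(g,e)$: $s(e^g)=(g,s(e))$, $t(e^g)=(g\,\ell(\lambda(e)),t(e))$, $\lambda^G(e^g)=(g,\lambda(e))$. Skew product: for a subshift $(\Lambda,\sigma)$ and continuous $\tau:\Lambda\to G$, $(G\ltimes\Lambda,\tau\ltimes\sigma)$ is the space $G\times\Lambda$ with the homeomorphism $(g,x)\mapsto(g\tau(x),\sigma(x))$ and the $G$-action $\rho_g(a,x)=(ga,x)$. *)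

(* Defs.v *)
From HB Require Import structures.
From mathcomp Require Import all_boot all_order all_algebra all_fingroup.
From mathcomp Require Import mathcomp_extra boolp classical_sets functions.
From mathcomp Require Import topology.
From mathcomp Require Import zify.
Set Implicit Arguments.
Unset Strict Implicit.
Unset Printing Implicit Defensive.
Import GRing.Theory.

Local Open Scope classical_set_scope.

(* Sigma^Z with the product of the discrete topologies. *)
Notation biseq Sigma := {ptws int -> discrete_topology Sigma}.

Definition shift (Sigma : finType) (x : biseq Sigma) : biseq Sigma :=
  fun i => x (i + 1)%R.

Record subshift (Sigma : finType) := Subshift {
  subshift_set :> set (biseq Sigma);
  subshift_closed : closed subshift_set;
  subshift_invariant : @shift Sigma @` subshift_set = subshift_set
}.

Lemma subshift_shift (Sigma : finType) (X : subshift Sigma) (x : biseq Sigma) :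
  subshift_set X x -> subshift_set X (shift x).
Proof. by move=> Xx; rewrite -(subshift_invariant X); exists x. Qed.

(* The shift as a self-map of X, where X is seen as a topological space through
   the subspace topology that the library puts on [set_type]. *)
Definition subshift_map (Sigma : finType) (X : subshift Sigma) (x : X) : X :=
  SigSub (mem_set (subshift_shift (set_valP x))).

Definition window (Sigma : finType) (x : biseq Sigma) (i : int) (n : nat) :
  seq Sigma := [seq x (i + k%:Z)%R | k <- iota 0 n].

Definition admissible (Sigma : finType) (X : subshift Sigma) (w : seq Sigma) :=
  exists x i, subshift_set X x /\ window x i (size w) = w.

(* [lE l] is E_{l,l+1} and [liota l] is iota_{l,l+1}.  Conditions of the form
   "for l >= 1" are stated with l+1 in place of l. *)
Record lambda_graph (Sigma : finType) := LambdaGraph {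
  lV : nat -> finType;
  lE : nat -> finType;
  lsrc : forall l, lE l -> lV l;
  ltgt : forall l, lE l -> lV l.+1;
  llab : forall l, lE l -> Sigma;
  liota : forall l, lV l.+1 -> lV l;
  liota_surj : forall l (u : lV l), exists v, liota v = u;
  lsrc_surj : forall l (u : lV l), exists e, lsrc e = u;
  ltgt_surj : forall l (v : lV l.+1), exists e, ltgt e = v;
  llab_iota : forall l (v : lV l.+2) (a : Sigma),
    (exists e : lE l.+1, llab e = a /\ ltgt e = v) <->
    (exists e : lE l, llab e = a /\ ltgt e = liota v);
  llocal : forall l (u : lV l) (v : lV l.+2),
    exists f : {e : lE l.+1 | (ltgt e == v) && (liota (lsrc e) == u)} ->
               {e : lE l | (lsrc e == u) && (ltgt e == liota v)},
      bijective f /\ forall e, llab (val (f e)) = llab (val e);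
  lresolving : forall l (e f : lE l),
    e <> f -> llab e = llab f -> ltgt e <> ltgt f
}.

(* [path_label v w] : some path starting at v has label word w. *)
Fixpoint path_label (Sigma : finType) (L : lambda_graph Sigma) (l : nat)
    (v : lV L l) (w : seq Sigma) : Prop :=
  match w with
  | [::] => True
  | a :: w' => exists e : lE L l,
      [/\ lsrc e = v, llab e = a & path_label (ltgt e) w']
  end.

Definition label_word (Sigma : finType) (L : lambda_graph Sigma)
    (w : seq Sigma) : Prop :=
  exists l (v : lV L l), path_label v w.

Definition presents (Sigma : finType) (L : lambda_graph Sigma)
    (X : subshift Sigma) : Prop :=
  forall w, admissible X w <-> label_word L w.

(* Every lambda-graph system presents exactly one subshift. *)
Section Presentation.
Variables (Sigma : finType) (L : lambda_graph Sigma).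

Let pset : set (biseq Sigma) := [set x | forall i n, label_word L (window x i n)].

Let size_window (x : biseq Sigma) i n : size (window x i n) = n.
Proof. by rewrite size_map size_iota. Qed.

Let window_shift (x : biseq Sigma) i n :
  window (shift x) i n = window x (i + 1)%R n.
Proof. by apply: eq_map => k; rewrite /shift addrAC. Qed.

Let pset_invariant : @shift Sigma @` pset = pset.
Proof.
apply/seteqP; split=> [_ [x px <-] i n|x px]; first by rewrite window_shift.
pose y : biseq Sigma := fun i : int => x (i - 1)%R.
have yx : shift y = x by apply/funext => i; rewrite /shift /y addrK.
exists y => // i n.
by rewrite -(subrK 1%R i) -window_shift yx.
Qed.

Let nbhs_window (x : biseq Sigma) i n :
  nbhs x [set y : biseq Sigma | window y i n = window x i n].
Proof.
rewrite /window; elim: (iota 0 n) => [|k s IH] /=.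
  by apply: filterS filterT.
have /= ck : nbhs x [set y : biseq Sigma | y (i + k%:Z)%R = x (i + k%:Z)%R].
  apply: (@proj_continuous _ (fun _ : int => discrete_topology Sigma)
            (i + k%:Z)%R x [set x (i + k%:Z)%R]).
  exact: (@discrete_set1 (discrete_topology Sigma)).
by apply: filterS (filterI ck IH) => y [/= -> ->].
Qed.

Let pset_closed : closed pset.
Proof.
move=> x clx i n.
by have [y [py /= <-]] := clx _ (nbhs_window x i n).
Qed.

Let path_label_catl l (v : lV L l) w1 w2 :
  path_label v (w1 ++ w2) -> path_label v w1.
Proof.
elim: w1 l v => [|a w1 IH] l v //= [e [se le pe]].
by exists e; split=> //; exact: IH pe.
Qed.

Let path_label_catr l (v : lV L l) w1 w2 :
  path_label v (w1 ++ w2) -> label_word L w2.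
Proof.
elim: w1 l v => [|a w1 IH] l v /=; first by exists l, v.
by move=> [e [_ _ pe]]; exact: IH pe.
Qed.

Let label_word_sub w1 w2 w3 : label_word L (w1 ++ w2 ++ w3) -> label_word L w2.
Proof.
move=> [l [v /path_label_catr[m [u /path_label_catl p]]]]; by exists m, u.
Qed.

Let path_label_rcons l (v : lV L l) w :
  path_label v w -> exists a, path_label v (rcons w a).
Proof.
elim: w l v => [|b w IH] l v /=.
  by move=> _; have [e se] := lsrc_surj v; exists (llab e), e; split.
by move=> [e [se le /IH[a pa]]]; exists a, e; split.
Qed.

Let path_label_lift w l (v : lV L l) :
  path_label v w -> exists v' : lV L l.+1, path_label v' w.
Proof.
suff H : path_label v w -> exists v' : lV L l.+1,
    liota v' = v /\ path_label v' w by move=> /H[v' [_ ?]]; exists v'.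
elim: w l v => [|a w IH] l v /=.
  by move=> _; have [v' v'v] := liota_surj v; exists v'.
move=> [e [se le /IH[v1 [iv1 p1]]]].
have [f [[g fK gK] flab]] := llocal v v1.
have eP : (lsrc e == v) && (ltgt e == liota v1) by rewrite se iv1 !eqxx.
pose e' := g (exist _ e eP).
have /andP[/eqP te' /eqP ie'] := valP e'.
exists (lsrc (val e')); split=> //; exists (val e'); split=> //.
  by rewrite -flab gK.
by rewrite te'.
Qed.

Let label_word_extend w : label_word L w ->
  exists ab : Sigma * Sigma, label_word L (ab.1 :: rcons w ab.2).
Proof.
move=> [l [v /path_label_lift[v' /path_label_rcons[b p]]]].
have [e te] := ltgt_surj v'.
by exists (llab e, b), l, (lsrc e), e; split=> //; rewrite te.
Qed.

Let label_word_point w : label_word L w ->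
  exists x : biseq Sigma, pset x /\ window x 0 (size w) = w.
Proof.
move=> lw.
have [ext extP] : exists ext : {w | label_word L w} -> Sigma * Sigma,
    forall u, label_word L ((ext u).1 :: rcons (sval u) (ext u).2).
  exists (fun u => sval (cid (label_word_extend (svalP u)))) => u.
  exact: (svalP (cid (label_word_extend (svalP u)))).
pose step (u : {w | label_word L w}) : {w | label_word L w} :=
  exist _ _ (extP u).
pose W k := sval (iter k step (exist _ w lw)).
have lW k : label_word L (W k) by exact: svalP.
have WS k : W k.+1 = (ext (iter k step (exist _ w lw))).1 ::
    rcons (W k) (ext (iter k step (exist _ w lw))).2 by [].
have sW k : size (W k) = (size w + k.*2)%N.
  elim: k => [|k IH]; first by rewrite addn0.
  by rewrite WS /= size_rcons IH doubleS !addnS.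
pose d := (ext (exist _ w lw)).1.
have WD k m j : (j < size (W k))%N -> nth d (W (m + k)) (m + j) = nth d (W k) j.
  move=> jk; elim: m => [|m IH] //; rewrite !addSn WS /= nth_rcons.
  by rewrite ifT //; move: jk; rewrite !sW; lia.
pose x : biseq Sigma := fun i : int => nth d (W `|i|.+1) `|(i + `|i|.+1%:Z)%R|.
have xE k (j : nat) : (j < size (W k))%N -> x (j%:Z - k%:Z)%R = nth d (W k) j.
  move=> jk; rewrite /x; set k' := `|_|.+1; set j' := `|_|%N.
  have j'k' : (j' < size (W k'))%N by rewrite sW /j' /k'; lia.
  rewrite -(WD k' k) // -(WD k k') // addnC; congr nth.
  by rewrite /j' /k'; lia.
exists x; split.
  move=> i n; pose k := (`|i| + n)%N; pose j0 := `|(i + k%:Z)%R|%N.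
  have j0k : (j0 + n <= size (W k))%N by rewrite sW /j0 /k; lia.
  apply: (@label_word_sub (take j0 (W k)) _ (drop n (drop j0 (W k)))).
  suff -> : window x i n = take n (drop j0 (W k)) by rewrite !cat_take_drop.
  apply: (@eq_from_nth _ d) => [|j]; rewrite size_window.
    by rewrite size_take_min size_drop; lia.
  move=> jn; rewrite (nth_map 0%N) ?size_iota // nth_iota // add0n.
  rewrite nth_take // nth_drop -xE; last by lia.
  by congr x; rewrite /j0 /k; lia.
apply: (@eq_from_nth _ d) => [|j]; rewrite size_window // => jw.
rewrite (nth_map 0%N) ?size_iota // nth_iota // add0n add0r.
by rewrite -[(j%:Z)%R]subr0 (xE 0%N).
Qed.

Let nbhs_cylinder (x : biseq Sigma) (U : set (biseq Sigma)) : nbhs x U ->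
  exists k : nat, forall y : biseq Sigma,
    (forall i : int, (`|i| <= k)%N -> y i = x i) -> U y.
Proof.
pose C k : set (biseq Sigma) :=
  [set y | forall i : int, (`|i| <= k)%N -> y i = x i].
have FF : Filter (filter_from setT C).
  apply: filter_from_filter; first by exists 0%N.
  move=> i j _ _; exists (maxn i j) => // y /= yx.
  by split=> k ki; apply: yx; lia.
suff Fx : filter_from setT C --> x by move=> /Fx[k _ CU]; exists k.
apply/cvg_sup => i A [_ [[V oV <-] Vx VA]].
exists `|i|%N => // y Cy; apply: VA => /=.
by rewrite (Cy i).
Qed.

Let subshift_translate (Z : subshift Sigma) (y : biseq Sigma) (i : int) :
  subshift_set Z y -> subshift_set Z (fun j => y (j + i)%R).
Proof.
have pos (n : nat) : subshift_set Z y -> subshift_set Z (fun j => y (j + n%:Z)%R).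
  elim: n => [|n IH] Zy.
    by rewrite (_ : (fun _ => _) = y) //; apply/funext => j; rewrite addr0.
  rewrite (_ : (fun _ => _) = shift (fun j => y (j + n%:Z)%R)).
    exact/subshift_shift/IH.
  by apply/funext => j; rewrite /shift; congr y; lia.
have neg (n : nat) : subshift_set Z y -> subshift_set Z (fun j => y (j - n%:Z)%R).
  elim: n => [|n IH] Zy.
    by rewrite (_ : (fun _ => _) = y) //; apply/funext => j; rewrite subr0.
  have := IH Zy; rewrite -[X in X _](subshift_invariant Z) => -[z Zz zy].
  rewrite (_ : (fun _ => _) = z) //; apply/funext => j.
  have /(congr1 (fun f => f (j - 1)%R)) := zy.
  by rewrite /shift subrK => ->; congr y; lia.
by case: (intP i) => [|n|n]; [exact: (pos 0%N)|exact: pos|exact: neg].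
Qed.

Lemma presents_exists : exists X : subshift Sigma, presents L X.
Proof.
exists (Subshift pset_closed pset_invariant) => w; split.
  by move=> [x [i [px <-]]]; exact: px.
by move=> /label_word_point[x [px xw]]; exists x, 0%R.
Qed.

Lemma presents_unique (X Y : subshift Sigma) :
  presents L X -> presents L Y -> subshift_set X = subshift_set Y.
Proof.
suff H (Z : subshift Sigma) : presents L Z -> subshift_set Z = pset.
  by move=> /H-> /H->.
move=> pZ; apply/seteqP; split=> x.
  move=> Zx i n; apply/pZ; exists x, i; split=> //.
  by rewrite size_window.
move=> px; apply: (subshift_closed (s := Z)) => U /nbhs_cylinder[k kU].
have /pZ[y [i [Zy]]] := px (- k%:Z)%R (k.*2.+1); rewrite size_window => yx.
exists (fun j => y (j + (i + k%:Z))%R); split; first exact: subshift_translate.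
apply: kU => j jk.
have ->: (j + (i + k%:Z) = i + `|(j + k%:Z)%R|%N%:Z)%R by lia.
have -> : x j = x (- k%:Z + `|(j + k%:Z)%R|%N%:Z)%R by congr x; lia.
have jk2 : (`|(j + k%:Z)%R| < k.*2.+1)%N by lia.
have /(congr1 (fun s => nth (x 0%R) s `|(j + k%:Z)%R|)) := yx.
by rewrite !(nth_map 0%N) ?size_iota // nth_iota.
Qed.

End Presentation.

Section Extension.
Variables (G : finGroupType) (Sigma : finType) (ell : Sigma -> G).
Variable L : lambda_graph Sigma.

Let xV l : finType := (G * lV L l)%type.
Let xE l : finType := (G * lE L l)%type.
Let xsrc l (e : xE l) : xV l := (e.1, lsrc e.2).
Let xtgt l (e : xE l) : xV l.+1 := ((e.1 * ell (llab e.2))%g, ltgt e.2).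
Let xlab l (e : xE l) : (G * Sigma)%type := (e.1, llab e.2).
Let xiota l (v : xV l.+1) : xV l := (v.1, liota v.2).

Let xiota_surj l (u : xV l) : exists v, xiota v = u.
Proof.
by case: u => g u; have [v <-] := liota_surj u; exists (g, v).
Qed.

Let xsrc_surj l (u : xV l) : exists e, xsrc e = u.
Proof. by case: u => g u; have [e <-] := lsrc_surj u; exists (g, e). Qed.

Let xtgt_surj l (v : xV l.+1) : exists e, xtgt e = v.
Proof.
case: v => g v; have [e <-] := ltgt_surj v.
by exists ((g * (ell (llab e))^-1)%g, e); rewrite /xtgt /= mulgKV.
Qed.

Let xlab_iota l (v : xV l.+2) (a : G * Sigma) :
  (exists e : xE l.+1, xlab e = a /\ xtgt e = v) <->
  (exists e : xE l, xlab e = a /\ xtgt e = xiota v).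
Proof.
case: v a => h v [g a]; split=> -[[g' e] [[-> la] [hE te]]].
  have /llab_iota[f [lf tf]] : exists e, llab e = a /\ ltgt e = v by exists e.
  by exists (g, f); rewrite /xlab /xtgt /xiota /= lf tf -hE la.
have /llab_iota[f [lf tf]] : exists e, llab e = a /\ ltgt e = liota v.
  by exists e.
by exists (g, f); rewrite /xlab /xtgt /= lf tf -hE la.
Qed.

Let xlocal l (u : xV l) (v : xV l.+2) :
  exists f : {e : xE l.+1 | (xtgt e == v) && (xiota (xsrc e) == u)} ->
             {e : xE l | (xsrc e == u) && (xtgt e == xiota v)},
    bijective f /\ forall e, xlab (val (f e)) = xlab (val e).
Proof.
case: u v => a u [b v]; have [f [[f' fK f'K] flab]] := llocal u v.
have f'lab e : llab (val (f' e)) = llab (val e) by rewrite -flab f'K.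
have upP (e : {e : xE l.+1 | (xtgt e == (b, v)) && (xiota (xsrc e) == (a, u))}) :
    (ltgt (val e).2 == v) && (liota (lsrc (val e).2) == u).
  by case: e => -[g e] /= /andP[/eqP[_ ->] /eqP[_ ->]]; rewrite !eqxx.
have dnP (e : {e : xE l | (xsrc e == (a, u)) && (xtgt e == xiota (b, v))}) :
    (lsrc (val e).2 == u) && (ltgt (val e).2 == liota v).
  by case: e => -[g e] /= /andP[/eqP[_ ->] /eqP[_ ->]]; rewrite !eqxx.
pose up e := f (exist (fun e => (ltgt e == v) && (liota (lsrc e) == u))
  (val e).2 (upP e)).
pose dn e := f' (exist (fun e => (lsrc e == u) && (ltgt e == liota v))
  (val e).2 (dnP e)).
have fP e : (xsrc ((val e).1, val (up e)) == (a, u)) &&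
            (xtgt ((val e).1, val (up e)) == xiota (b, v)).
  rewrite /xsrc /xtgt /xiota /= flab /=.
  have /andP[/eqP-> /eqP->] := valP (up e).
  by case: e => -[g e] /= /andP[/eqP[-> _] /eqP[-> _]]; rewrite !eqxx.
have gP e : (xtgt ((val e).1, val (dn e)) == (b, v)) &&
            (xiota (xsrc ((val e).1, val (dn e))) == (a, u)).
  rewrite /xsrc /xtgt /xiota /= f'lab /=.
  have /andP[/eqP-> /eqP->] := valP (dn e).
  by case: e => -[g e] /= /andP[/eqP[-> _] /eqP[-> _]]; rewrite !eqxx.
pose F e : {e : xE l | (xsrc e == (a, u)) && (xtgt e == xiota (b, v))} :=
  exist _ ((val e).1, val (up e)) (fP e).
pose F' e : {e : xE l.+1 | (xtgt e == (b, v)) && (xiota (xsrc e) == (a, u))} :=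
  exist _ ((val e).1, val (dn e)) (gP e).
exists F; split; last by move=> e; rewrite /xlab /= flab.
exists F' => e; apply/val_inj; rewrite /F /F' /= /dn /up.
  set z := exist _ _ _; have -> : z = up e by exact/val_inj.
  by rewrite /up fK /=; case: (val e).
set z := exist _ _ _; have -> : z = dn e by exact/val_inj.
by rewrite /dn f'K /=; case: (val e).
Qed.

Let xresolving l (e f : xE l) : e <> f -> xlab e = xlab f -> xtgt e <> xtgt f.
Proof.
case: e f => g e [h f] ef [gh lef] [_ tef]; case: (pselect (e = f)) => [eqef|].
  by apply: ef; rewrite gh eqef.
by move=> /lresolving/(_ lef); exact.
Qed.

Definition extension : lambda_graph (G * Sigma)%type :=
  LambdaGraph xiota_surj xsrc_surj xtgt_surj xlab_iota xlocal xresolving.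

End Extension.

Definition homeomorphism (X Y : topologicalType) (f : X -> Y) :=
  exists h : Y -> X, [/\ cancel f h, cancel h f, continuous f & continuous h].

Definition G_system (G : finGroupType) (X : topologicalType) (T : X -> X)
    (rho : G -> X -> X) : Prop :=
  [/\ homeomorphism T,
      (forall x, rho 1%g x = x),
      (forall g h x, rho (g * h)%g x = rho g (rho h x)),
      (forall g, homeomorphism (rho g)) &
      (forall g x, rho g (T x) = T (rho g x))].

Definition G_subshift (G : finGroupType) (Sigma : finType) (X : subshift Sigma)
    (rho : G -> X -> X) : Prop :=
  G_system (@subshift_map Sigma X) rho.

Definition G_conjugate (G : finGroupType) (X Y : topologicalType)
    (S : X -> X) (rho : G -> X -> X) (T : Y -> Y) (rho' : G -> Y -> Y) : Prop :=
  [/\ G_system S rho, G_system T rho' &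
      exists f : X -> Y, [/\ homeomorphism f,
        (forall x, f (S x) = T (f x)) &
        (forall g x, f (rho g x) = rho' g (f x))]].

Section SkewProduct.
Variables (G : finGroupType) (Sigma : finType) (X : subshift Sigma).
Variable tau : X -> G.

Definition skew_space : topologicalType := (discrete_topology G * X)%type.

Definition skew_map (p : skew_space) : skew_space :=
  ((p.1 * tau p.2)%g, subshift_map p.2).

Definition skew_action (g : G) (p : skew_space) : skew_space :=
  ((g * p.1)%g, p.2).

End SkewProduct.

Definition tau_ell (G : finGroupType) (Sigma : finType) (ell : Sigma -> G)
    (X : subshift Sigma) (x : X) : G := ell (set_val x 0%R).

(* Main.v *)
(* The label sequences of paths in the extension are the words (g_n, x_n) where
   (x_n) labels a path in L and g_{n+1} = g_n ell(x_n).  Hence the subshift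
   presented by the extension is the set of all bi-infinite (g_n, x_n) with
   (x_n) in Lambda_L satisfying this recursion.  Such a point is determined by
   g_0 and (x_n), and (g_n, x_n) |-> (g_0, (x_n)) is the required conjugacy. *)
Require Import Defs.
From mathcomp Require Import all_boot all_order all_algebra all_fingroup.
From mathcomp Require Import boolp classical_sets functions topology.
From mathcomp Require Import zify.
Set Implicit Arguments.
Unset Strict Implicit.
Unset Printing Implicit Defensive.

Import GRing.Theory.

(** * Locally constant maps and continuity into a subshift *)

(** Continuity into a discrete space, phrased without a topology on [A]: post-composition with an
    arbitrary map then preserves it. *)
Definition locally_constant (T : topologicalType) (A : Type) (f : T -> A) :=
  forall t, nbhs t [set u | f u = f t]%classic.

Lemma locally_constant_comp (T : topologicalType) (A B : Type) (h : A -> B)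
    (f : T -> A) :
  locally_constant f -> locally_constant (fun t => h (f t)).
Proof. by move=> cf t; apply: filterS (cf t) => u /= ->. Qed.

Lemma locally_constant_op (T : topologicalType) (A B C : Type)
    (h : A -> B -> C) (f : T -> A) (g : T -> B) :
  locally_constant f -> locally_constant g ->
  locally_constant (fun t => h (f t) (g t)).
Proof.
by move=> cf cg t; apply: filterS (filterI (cf t) (cg t)) => u /= [-> ->].
Qed.

Lemma locally_constant_continuous (T U : topologicalType) (A : Type)
    (f : U -> A) (g : T -> U) :
  locally_constant f -> continuous g -> locally_constant (fun t => f (g t)).
Proof. by move=> cf cg t; exact: cg (cf (g t)). Qed.

Lemma continuous_discreteP (T : topologicalType) (A : choiceType)
    (f : T -> discrete_topology A) :
  continuous f <-> locally_constant f.
Proof.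
split=> [cf t|cf t U].
  by apply: (cf t [set f t]%classic); exact: (@discrete_set1 (discrete_topology A)).
by move=> /nbhs_singleton Uft; apply: filterS (cf t) => u /= ->.
Qed.

Lemma locally_constant_coord (Sigma : finType) (n : int) :
  locally_constant (fun x : biseq Sigma => x n).
Proof.
apply/(@continuous_discreteP (biseq Sigma) Sigma).
exact: (@proj_continuous _ (fun _ : int => discrete_topology Sigma) n).
Qed.

(** The product topology is the supremum of the topologies pulled back along the coordinates, so one
    coordinate can be treated at a time. *)
Lemma continuous_biseq (T : topologicalType) (Sigma : finType)
    (f : T -> biseq Sigma) :
  (forall n, locally_constant (fun t => f t n)) -> continuous f.
Proof.
move=> cf t; apply/cvg_sup => n U [_ [[V oV <-] Vx VU]].
by apply: filterS (cf n t) => u /= fu; apply: VU => /=; rewrite fu.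
Qed.

Lemma locally_constant_subshift_coord (Sigma : finType) (X : subshift Sigma)
    (n : int) :
  locally_constant (fun x : X => set_val x n).
Proof.
apply: (@locally_constant_continuous X (biseq Sigma) Sigma (fun x => x n)
  set_val); first exact: locally_constant_coord.
exact: initial_continuous.
Qed.

Lemma continuous_subshift (T : topologicalType) (Sigma : finType)
    (X : subshift Sigma) (f : T -> X) :
  (forall n, locally_constant (fun t => set_val (f t) n)) -> continuous f.
Proof.
move=> cf; apply: continuous_comp_initial.
exact: (@continuous_biseq T Sigma (fun t => set_val (f t))).
Qed.

Lemma subshift_eq (Sigma : finType) (X : subshift Sigma) (x y : X) :
  (forall n, set_val x n = set_val y n) -> x = y.
Proof. by move=> xy; apply/val_inj/funext. Qed.

Lemma continuous_pair (T U V : topologicalType) (f : T -> U) (g : T -> V) :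
  continuous f -> continuous g ->
  continuous (fun t => (f t, g t) : (U * V)%type).
Proof. by move=> cf cg t; exact: cvg_pair (cf t) (cg t). Qed.

(** * Homeomorphisms and transport of $G$-systems *)

Lemma homeomorphism_comp (X Y Z : topologicalType) (f : X -> Y) (g : Y -> Z) :
  homeomorphism f -> homeomorphism g -> homeomorphism (fun x => g (f x)).
Proof.
move=> [f' [fK f'K cf cf']] [g' [gK g'K cg cg']].
exists (fun z => f' (g' z)); split=> [x|z|x|z]; rewrite ?gK ?f'K //.
- exact: (@continuous_comp _ _ _ f g x (cf x) (cg (f x))).
- exact: (@continuous_comp _ _ _ g' f' z (cg' z) (cf' (g' z))).
Qed.

(** Every map of the target system is the conjugate by [f] of its counterpart on the source. This
    spares a separate verification of the axioms for the skew product. *)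
Lemma G_system_transport (G : finGroupType) (X Y : topologicalType)
    (S : X -> X) (rho : G -> X -> X) (T : Y -> Y) (rho' : G -> Y -> Y)
    (f : X -> Y) :
  G_system S rho -> homeomorphism f -> (forall x, f (S x) = T (f x)) ->
  (forall g x, f (rho g x) = rho' g (f x)) -> G_system T rho'.
Proof.
move=> [hS rho1 rhoM hrho rhoS] hf fS frho.
have [f' [fK f'K cf cf']] := hf.
have hf' : homeomorphism f' by exists f.
have conj (s : X -> X) (t : Y -> Y) : homeomorphism s ->
    (forall x, f (s x) = t (f x)) -> homeomorphism t.
  move=> hs st; have -> : t = fun y => f (s (f' y)).
    by apply/funext => y; rewrite st f'K.
  exact: homeomorphism_comp (homeomorphism_comp hf' hs) hf.
split; first exact: conj hS fS.
- by move=> y; rewrite -(f'K y) -frho rho1.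
- by move=> g h y; rewrite -(f'K y) -!frho rhoM.
- by move=> g; exact: conj (hrho g) (frho g).
- by move=> g y; rewrite -(f'K y) -fS -!frho -fS rhoS.
Qed.

(** The inverse is the backward shift; it stays in [X] because invariance is an equality, so each
    point of [X] is the shift of another one. *)
Lemma subshift_map_homeomorphism (Sigma : finType) (X : subshift Sigma) :
  homeomorphism (@subshift_map Sigma X).
Proof.
have unshiftP (x : X) : subshift_set X (fun n => set_val x (n - 1)%R).
  have := set_valP x; rewrite -[Y in Y _](subshift_invariant X) => -[y Xy yx].
  rewrite (_ : (fun _ => _) = y) //; apply/funext => n.
  have <- : y (n - 1 + 1)%R = set_val x (n - 1)%R.
    exact: (congr1 (fun u => u (n - 1)%R) yx).
  by rewrite subrK.
pose unshift (x : X) : X := SigSub (mem_set (unshiftP x)).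
exists unshift; split.
- by move=> x; apply: subshift_eq => n; rewrite -[n in RHS](subrK 1%R).
- by move=> x; apply: subshift_eq => n; rewrite -[n in RHS](addrK 1%R).
- by apply: continuous_subshift => n; exact: locally_constant_subshift_coord.
- by apply: continuous_subshift => n; exact: locally_constant_subshift_coord.
Qed.

Lemma windowS (Sigma : finType) (x : biseq Sigma) (i : int) (n : nat) :
  window x i n.+1 = x i :: window x (i + 1)%R n.
Proof.
rewrite /window /= addr0; congr (_ :: _).
rewrite -[1%N]addn0 iotaDl -map_comp; apply: eq_map => k /=.
by congr x; lia.
Qed.

(** * The cocycle generated by [ell] *)

Section Cocycle.
Variables (G : finGroupType) (Sigma : finType) (ell : Sigma -> G).
Local Open Scope group_scope.

(* The iterates of tau_ell: tau_ell^n(x) = ell(x_0) ... ell(x_{n-1}) for n >= 0,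
   extended to n < 0 by the cocycle identity. *)
Definition cocycle (x : biseq Sigma) (n : int) : G :=
  match n with
  | Posz k => \prod_(i < k) ell (x i%:Z%R)
  | Negz k => (\prod_(i < k.+1) ell (x (i%:Z - k.+1%:Z)%R))^-1
  end.

Lemma cocycle0 x : cocycle x 0%R = 1.
Proof. exact: big_ord0. Qed.

Lemma cocycleS x n : cocycle x (n + 1)%R = cocycle x n * ell (x n).
Proof.
case: n => k; first by rewrite /= addn1 big_ord_recr.
(* [Negz k] is $-(k+1)$, so its successor is $-k$. For $k=0$ it falls in the [Posz] branch, where
   both products are empty. *)
have -> : cocycle x (Negz k + 1)%R =
    (\prod_(i < k) ell (x (i%:Z - k%:Z)%R))^-1.
  case: k => [|k]; first by rewrite /= !big_ord0 invg1.
  by have -> : (Negz k.+1 + 1 = Negz k)%R by lia.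
(* The first factor, at index $-(k+1)$, becomes the last one after inversion and cancels against
   [ell (x (Negz k))]. *)
rewrite /= big_ord_recl invMg; set a := ell (x (Negz k)).
have -> : ell (x (Posz (@ord0 k) - k.+1%:Z)%R) = a.
  by rewrite /= sub0r -NegzE.
rewrite mulgKV; congr (_^-1); apply: eq_bigr => i _.
by congr (ell (x _)); rewrite /= /bump; lia.
Qed.

(** Both sides obey the same first-order recursion and agree at 0; the equality propagates forward
    by substitution and backward by cancellation in the group. *)
Lemma cocycle_unique (x : biseq Sigma) (g : int -> G) :
  (forall n, g (n + 1)%R = g n * ell (x n)) ->
  forall n, g n = g 0%R * cocycle x n.
Proof.
move=> gS; elim/int_rect => [|n IH|n IH]; first by rewrite cocycle0 mulg1.
  by rewrite -addn1 PoszD gS cocycleS IH mulgA.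
have nE : (- n%:Z = - n.+1%:Z + 1)%R by lia.
by move: IH; rewrite nE gS cocycleS mulgA => /mulIg.
Qed.

(** Only finitely many coordinates of [x] enter: each step away from 0, in either direction, adds
    one factor. *)
Lemma locally_constant_cocycle (X : subshift Sigma) n :
  locally_constant (fun x : X => cocycle (set_val x) n).
Proof.
have cell m : locally_constant (fun x : X => ell (set_val x m)).
  exact/locally_constant_comp/locally_constant_subshift_coord.
elim/int_rect: n => [|n IH|n IH].
- by move=> x; apply: filterS filterT => y _; rewrite /mkset !cocycle0.
- rewrite -addn1 PoszD (_ : (fun _ => _) = fun x : X =>
    cocycle (set_val x) n * ell (set_val x n)).
    exact: locally_constant_op IH (cell _).
  by apply/funext => x; rewrite cocycleS.
- rewrite (_ : (fun _ => _) = fun x : X =>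
    cocycle (set_val x) (- n%:Z)%R * (ell (set_val x (- n.+1%:Z)%R))^-1).
    exact: (locally_constant_op (fun a b => a * b^-1) IH (cell _)).
  apply/funext => x; rewrite (_ : - n%:Z = - n.+1%:Z + 1)%R; last by lia.
  by rewrite cocycleS mulgK.
Qed.

(** * Skew-recursive points and the label words of the extension *)

Definition drop_fiber (z : biseq (G * Sigma)%type) : biseq Sigma :=
  fun n => (z n).2.

Definition skew_recursion (z : biseq (G * Sigma)%type) :=
  forall n, (z (n + 1)%R).1 = (z n).1 * ell (z n).2.

Definition lift_point (a : G) (x : biseq Sigma) : biseq (G * Sigma)%type :=
  fun n => (a * cocycle x n, x n).

Lemma lift_point_recursion a x : skew_recursion (lift_point a x).
Proof. by move=> n; rewrite /= cocycleS mulgA. Qed.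

Lemma lift_point_drop_fiber z : skew_recursion z ->
  lift_point (z 0%R).1 (drop_fiber z) = z.
Proof.
move=> zS; apply/funext => n; rewrite [RHS]surjective_pairing.
congr pair; symmetry.
exact: (cocycle_unique (x := drop_fiber z) (g := fun m => (z m).1) zS).
Qed.

(** Finite analogue of [lift_point]: the labels read along the lift, started at level [g], of a path
    labeled [s]. *)
Fixpoint lift_word (g : G) (s : seq Sigma) : seq (G * Sigma)%type :=
  if s is a :: s' then (g, a) :: lift_word (g * ell a) s' else [::].

Lemma size_lift_word g s : size (lift_word g s) = size s.
Proof. by elim: s g => //= a s IH g; rewrite IH. Qed.

Lemma window_skew_recursion z i n : skew_recursion z ->
  window z i n = lift_word (z i).1 (window (drop_fiber z) i n).
Proof.
move=> zS; elim: n i => [|n IH] i //; rewrite !windowS /= IH zS.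
by rewrite {2}/drop_fiber -surjective_pairing.
Qed.

(** The source of an edge [(h, e)] forces [h] to be the current group element, and its terminal
    multiplies it by [ell] of the label. The group coordinates of a path are thus determined by [g]
    and the path in [L]. *)
Lemma path_label_extension (L : lambda_graph Sigma) l (g : G) (v : lV L l) w :
  path_label (L := extension ell L) (l := l) (g, v) w <->
  exists2 s, w = lift_word g s & path_label v s.
Proof.
elim: w l g v => [|[h a] w IH] l g v; first by split=> // _; exists [::].
split=> [[[k e] [[-> ev] [-> ea] /IH[s -> p]]]|[[|b s] //= [-> -> ws]]].
  by exists (a :: s); rewrite /= -ea //; exists e.
move=> [e [ev eb p]]; exists (g, e); split; rewrite /= ?ev ?eb //.
by apply/IH; exists s.
Qed.

(** * The subshift presented by the extension *)

Definition skew_set (X : subshift Sigma) : set (biseq (G * Sigma)%type) :=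
  [set z | subshift_set X (drop_fiber z) /\ skew_recursion z]%classic.

(** [drop_fiber] is continuous and [X] is closed; the recursion at [n] involves only coordinates [n]
    and [n + 1], on which a nearby point of the set agrees with [z]. *)
Lemma skew_set_closed (X : subshift Sigma) : closed (skew_set X).
Proof.
move=> z clz; split=> [|n].
  apply: (subshift_closed (s := X)) => U Uz.
  have cd : continuous drop_fiber.
    apply: continuous_biseq => n.
    exact/(locally_constant_comp snd)/locally_constant_coord.
  have [y [[Xy _] Uy]] := clz _ (cd z U Uz).
  by exists (drop_fiber y).
have [y [[_ yS] [/= <- <-]]] := clz _ (filterI
  (locally_constant_coord n z) (locally_constant_coord (n + 1)%R z)).
exact: yS.
Qed.

Lemma skew_set_invariant (X : subshift Sigma) :
  (@shift _ @` skew_set X = skew_set X)%classic.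
Proof.
apply/seteqP; split=> [_ [z [Xz zS] <-]|z [Xz zS]].
  by split=> [|n]; [exact: (subshift_shift Xz)|exact: zS].
exists (fun n => z (n - 1)%R); last first.
  by apply/funext => n; rewrite /shift addrK.
split=> [|n]; last by rewrite -zS addrAC.
move: Xz; rewrite -[Y in Y _](subshift_invariant X) => -[y Xy yz].
rewrite (_ : drop_fiber _ = y) //; apply/funext => n.
have /(congr1 (fun u => u (n - 1)%R)) := yz.
by rewrite /shift subrK.
Qed.

(** On both sides the words are the [lift_word g s] with [s] a label word of [L], equivalently an
    admissible word of [X]. *)
Lemma presents_skew_set (L : lambda_graph Sigma) (X : subshift Sigma) :
  presents L X ->
  presents (extension ell L)
    (Subshift (@skew_set_closed X) (skew_set_invariant X)).
Proof.
move=> hX w; split.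
  move=> [z [i [[Xz zS] <-]]]; rewrite window_skew_recursion //.
  set s := window (drop_fiber z) _ _.
  have [l [v p]] : label_word L s.
    apply/hX; exists (drop_fiber z), i; split=> //.
    by rewrite /s size_map size_iota.
  by exists l, ((z i).1, v); apply/path_label_extension; exists s.
move=> [l [[g v] /path_label_extension[s -> p]]].
have [|x [i [Xx xs]]] := (hX s).2; first by exists l, v.
(* The value at 0 is chosen so that the group coordinate at position [i] is [g]. *)
exists (lift_point (g * (cocycle x i)^-1) x), i; split.
  by split=> //; exact: lift_point_recursion.
rewrite window_skew_recursion; last exact: lift_point_recursion.
by rewrite /= mulgKV size_lift_word [window _ _ _]xs.
Qed.

End Cocycle.

(** * The action and the conjugacy *)

Theorem theorem1p2 (G : finGroupType) (Sigma : finType)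
    (L : lambda_graph Sigma) (ell : Sigma -> G)
    (X : subshift Sigma) (hX : presents L X)
    (XG : subshift (G * Sigma)%type) (hXG : presents (extension ell L) XG) :
  exists rho : G -> XG -> XG,
    [/\ forall (g : G) (x : XG) (n : int),
          set_val (rho g x) n = ((g * (set_val x n).1)%g, (set_val x n).2),
        G_subshift rho &
        G_conjugate (@subshift_map _ XG) rho
          (skew_map (tau_ell ell (X := X))) (@skew_action G Sigma X)].
Proof.
(* Uniqueness of the presented subshift turns the abstract [XG] into an explicit set of points. *)
have XGE : subshift_set XG = skew_set ell X.
  by rewrite (presents_unique hXG (presents_skew_set ell hX)).
have memXG z : skew_set ell X z -> subshift_set XG z by rewrite XGE.
have XGP (x : XG) : skew_set ell X (set_val x).
  by rewrite -XGE; exact: set_valP.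
(* Left multiplication by [g] commutes with the right multiplications of the recursion. *)
have rhoP (g : G) (x : XG) : subshift_set XG
    (fun n => ((g * (set_val x n).1)%g, (set_val x n).2)).
  apply: memXG; have [Xx xS] := XGP x; split=> // n /=.
  by rewrite xS mulgA.
pose rho (g : G) (x : XG) : XG := SigSub (mem_set (rhoP g x)).
have rhoE g x n :
  set_val (rho g x) n = ((g * (set_val x n).1)%g, (set_val x n).2) by [].
have crho g : continuous (rho g).
  apply: continuous_subshift => n.
  exact: (locally_constant_comp (fun p : G * Sigma => ((g * p.1)%g, p.2))
    (locally_constant_subshift_coord n)).
have rho1 x : rho 1%g x = x.
  by apply: subshift_eq => n; rewrite rhoE mul1g -surjective_pairing.
have rhoM g h x : rho (g * h)%g x = rho g (rho h x).
  by apply: subshift_eq => n; rewrite !rhoE mulgA.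
have Grho : G_subshift rho.
  split=> //; first exact: subshift_map_homeomorphism.
    move=> g; exists (rho g^-1%g); split=> // x; rewrite -rhoM.
      by rewrite mulVg rho1.
    by rewrite mulgV rho1.
  by move=> g x; exact: subshift_eq.
pose f (x : XG) : skew_space G X :=
  ((set_val x 0%R).1, SigSub (mem_set (proj1 (XGP x)))).
have hP (p : skew_space G X) :
    subshift_set XG (lift_point ell p.1 (set_val p.2)).
  apply: memXG; split; last exact: lift_point_recursion.
  exact: (set_valP p.2).
pose h (p : skew_space G X) : XG := SigSub (mem_set (hP p)).
have hf : homeomorphism f.
  exists h; split.
  - move=> x; apply: val_inj; have [_ xS] := XGP x.
    exact: lift_point_drop_fiber xS.
  - move=> [a x]; congr pair; last exact: subshift_eq.
    (* The lift of [(a, x)] has group coordinate [a] at 0 because the cocycle is trivial there. *)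
    by rewrite -[RHS]mulg1 -(cocycle0 ell (set_val x)).
  - apply: (@continuous_pair XG (discrete_topology G) X
      (fun x => (set_val x 0%R).1)
      (fun x => SigSub (mem_set (proj1 (XGP x))))).
      apply/continuous_discreteP.
      exact/(locally_constant_comp fst)/locally_constant_subshift_coord.
    apply: continuous_subshift => n.
    exact/(locally_constant_comp snd)/locally_constant_subshift_coord.
  - apply: continuous_subshift => n.
    have c2 (A : Type) (k : X -> A) : locally_constant k ->
        locally_constant (fun p : skew_space G X => k p.2).
      by move=> ck; apply: locally_constant_continuous ck _ => p; exact: cvg_snd.
    apply: (locally_constant_op (@pair G Sigma)); last first.
      exact/(c2 _ (fun x : X => set_val x n))/locally_constant_subshift_coord.
    apply: (locally_constant_op mulg); last first.
      exact/(c2 _ (fun x : X => cocycle ell (set_val x) n))/locally_constant_cocycle.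
    by apply/continuous_discreteP => p; exact: cvg_fst.
have fS x : f (subshift_map x) = skew_map (tau_ell ell (X := X)) (f x).
  rewrite /f /skew_map /=; congr pair; last exact: subshift_eq.
  (* The recursion at 0, $g_1=g_0\,\ell(x_0)$, is the first coordinate of the skew map. *)
  by have [_ xS] := XGP x; exact: (xS 0%R).
have frho g x : f (rho g x) = skew_action g (f x).
  by rewrite /f /skew_action /=; congr pair; exact: subshift_eq.
exists rho; split=> //; split=> //; last by exists f.
exact: G_system_transport Grho hf fS frho.
Qed.
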